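(* For every real $\epsilon$ with $0<\epsilon<0.5$ there is a real constant $\delta=\delta(\epsilon)>0$ such that the following holds. Let $n$ be a positive integer, let $r=2c$ for an odd integer $c$ with $1\le c\le\frac{n}{2}$, and let $k$ be an even integer with $\epsilon n<k<(1-\epsilon)n$. Then $\gamma(n,k,r)\geq\delta n$.
   Context: $[n]=\{1,\ldots,n\}$. A bicoloring of $[n]$ is a map $B:[n]\to\{-1,+1\}$; it is a $k$-bicoloring if it takes the value $+1$ on exactly $k$ points. Put $Y_B=(B(1),\ldots,B(n))$, and for $A\subseteq[n]$ let $X_A\in\{0,1\}^n$ be its incidence vector. A non-empty set $A\subseteq[n]$ is an unbiased representative for $B$ if $\langle X_A,Y_B\rangle=0$. A family $\mathcal{A}$ of subsets of $[n]$ is a system of unbiased representatives (SUR) for a set $\mathcal{B}$ of bicolorings if every $B\in\mathcal{B}$ has an unbiased representative in $\mathcal{A}$. $\gamma(n,k,r)$ is the maximum, over all sets $\mathcal{B}$ of $k$-bicolorings of $[n]$, of the minimum cardinality of a SUR for $\mathcal{B}$ all of whose members have cardinality exactly $r$; equivalently, it is this minimum cardinality when $\mathcal{B}$ is the set of all $\binom{n}{k}$ $k$-bicolorings. (If no such SUR exists, the minimum is read as $+\infty$.) *)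

(* Defs.v *)
From mathcomp Require Import all_boot all_order all_algebra.
From mathcomp Require Import constructive_ereal.

Set Implicit Arguments.
Unset Strict Implicit.
Unset Printing Implicit Defensive.

Import Order.TTheory GRing.Theory Num.Theory.
Local Open Scope ring_scope.

(* A bicoloring of [n]; [true] encodes the colour +1 and [false] the colour
   -1, so that the bicolorings form a finite type. *)
Definition bicoloring (n : nat) := {ffun 'I_n -> bool}.

Definition Yvec (n : nat) (B : bicoloring n) : 'rV[int]_n :=
  \row_i (if B i then 1 else - 1).

Definition Xvec (n : nat) (A : {set 'I_n}) : 'rV[int]_n :=
  \row_i (if i \in A then 1 else 0).

Definition inner (n : nat) (u v : 'rV[int]_n) : int :=
  \sum_i u ord0 i * v ord0 i.

Definition is_kbicoloring (n k : nat) (B : bicoloring n) : bool :=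
  #|[set i | Yvec B ord0 i == 1]| == k.

Definition unbiased_rep (n : nat) (A : {set 'I_n}) (B : bicoloring n) : bool :=
  (A != set0) && (inner (Xvec A) (Yvec B) == 0).

Definition is_SUR (n : nat) (AA : {set {set 'I_n}}) (BB : {set bicoloring n})
    : bool :=
  [forall B in BB, exists A in AA, unbiased_rep A B].

Definition uniform (n r : nat) (AA : {set {set 'I_n}}) : bool :=
  [forall A in AA, #|A| == r].

(* The empty minimum is +oo. *)
Definition min_SUR (R : realDomainType) (n r : nat) (BB : {set bicoloring n})
    : \bar R :=
  \big[Order.min/+oo%E]_(AA : {set {set 'I_n}} | uniform r AA && is_SUR AA BB)
    (#|AA|%:R)%:E.

(* The range is never empty (it contains BB = set0), so the default value -oo
   does not affect the maximum. *)
Definition gamma (R : realDomainType) (n k r : nat) : \bar R :=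
  \big[Order.max/-oo%E]_(BB : {set bicoloring n}
                        | [forall B in BB, is_kbicoloring k B])
    min_SUR R r BB.

(* Main.v *)
Require Import Defs.
From mathcomp Require Import all_boot all_order all_algebra.
From mathcomp Require Import constructive_ereal reals.
From mathcomp Require Import ring lra zify.

Set Implicit Arguments.
Unset Strict Implicit.
Unset Printing Implicit Defensive.

Import Order.TTheory GRing.Theory Num.Theory.
Local Open Scope ring_scope.

(** A set A with #|A| = 2c, c odd, that is unbiased for the colour class K meets
    K in c points, an odd number. So it suffices to show that for a family F of
    fewer than delta n sets there is a k-set K meeting every member of F in an
    even number of points.
    First reduce the density: let V be a largest subset of a fixed set of size
    k - t, t about eps n / 6, that meets each member of F, and [n], evenly; by
    pigeonhole V misses at most #|F| + 1 points. It remains to find, in the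
    complement D of V, a set of the even size k' = k - #|V|, and
    eps #|D| / 12 <= k' <= #|D| / 4.
    The number of such sets, times 2 ^ #|F|, is the sum over J included in F of
    the character sums of (-1) ^ #|K :&: A_J| over the k'-subsets K of D, where
    A_J is the symmetric difference of the members of J. Each is a Krawtchouk
    coefficient of (1 - X) ^ a (1 + X) ^ b with a = #|D :&: A_J|, a + b = #|D|,
    and, k' being even, one may assume a <= b. It is nonnegative if
    16 a <= #|D|, and exponentially smaller than binomial(#|D|, k') otherwise,
    so the term binomial(#|D|, k') of J = set0 dominates the sum. *)

(** * Elementary estimates and the Krawtchouk recurrence *)

Lemma sqrn_lt_expn2 (q : nat) : (0 < q -> q ^ 2 < 4 * 2 ^ q)%N.
Proof.
move=> q_gt0; have h := ltn_expl (q./2) (isT : 1 < 2)%N.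
have e : (2 ^ (q./2) * 2 ^ (q./2) <= 2 ^ q)%N.
  by rewrite -expnD leq_exp2l // addnn; have := odd_double_half q; lia.
have := odd_double_half q; move: (odd q) => b /=; rewrite -mul2n => eq.
have : (q < 2 * (2 ^ q./2))%N by lia.
nia.
Qed.

Definition kraw (R : comNzRingType) (a b k : nat) : R :=
  ((1 - 'X) ^+ a * (1 + 'X) ^+ b : {poly R})`_k.

(* Compare coefficients in the derivative of [(1 - X) ^ a (1 + X) ^ b.+1] times
   [2 X = (1 + X) - (1 - X)]; the junk [a.-1] at [a = 0] has coefficient 0. *)
Lemma kraw_rec (R : comNzRingType) (a b k : nat) :
  b.+1%:R * kraw R a.+1 b k =
  ((a + b).+1%:R - k%:R *+ 2) * kraw R a b.+1 k - a%:R * kraw R a.-1 b.+2 k.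
Proof.
set P := (1 - 'X) ^+ a * (1 + 'X) ^+ b.+1 : {poly R}.
have dP : ('X * P^`()) *+ 2 = a%:R * P
   - a%:R * ((1 - 'X) ^+ a.-1 * (1 + 'X) ^+ b.+2)
   + b.+1%:R * P - b.+1%:R * ((1 - 'X) ^+ a.+1 * (1 + 'X) ^+ b).
  rewrite /P derivM !deriv_exp derivB derivD derivX derivC /= -mulr_natr.
  by case: {P} a => [|a] /=; rewrite !exprS; ring.
have cX : ('X * P^`())`_k = k%:R * P`_k.
  rewrite coefXM; case: k => [|k]; first by rewrite mul0r.
  by rewrite coef_deriv /= mulr_natl.
move/(congr1 (fun p : {poly R} => p`_k)): dP.
rewrite coefMn cX !(coefD, coefN) -!polyC_natr !coefCM /kraw -/P => e.
rewrite -addnS natrD.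
set K := P`_k in e *; set K1 := (_`_k) in e *; set K2 := (_`_k) in e *.
have {}e : b.+1%:R * K2 = a%:R * K - a%:R * K1 + b.+1%:R * K
   - k%:R * K *+ 2 by rewrite e; ring.
rewrite e; ring.
Qed.

Lemma bernoulli_inv (R : realDomainType) (x : R) (L : nat) :
  0 <= x -> x <= 1 -> (1 - x) ^+ L * (1 + L%:R * x) <= 1.
Proof.
move=> x0 x1; elim: L => [|L IH]; first by rewrite expr0 mul0r addr0 mul1r.
apply: le_trans IH; rewrite exprSr -mulrA ler_wpM2l //.
  by rewrite exprn_ge0 // subr_ge0.
have := sqr_ge0 x; have : 0 <= L%:R :> R by [].
rewrite -natr1; nra.
Qed.

Lemma geometric_decay (R : realType) (x : R) : 0 < x -> x <= 1 ->
  exists2 L : nat, (0 < L)%N & forall m j : nat, (L * m.+1 <= j)%N ->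
    2 ^+ m * ((16 * j).+1%:R * (1 - x) ^+ j) < 1.
Proof.
(* As [l * x >= 3], each block of [l] factors [1 - x] is at most [1 / 4]. *)
move=> x0 x1; pose l := (Num.truncn (3 / x)).+1.
have bl : (1 - x) ^+ l <= 1 / 4.
  have := bernoulli_inv l (ltW x0) x1.
  have : 3 <= l%:R * x by rewrite -ler_pdivrMr // ltW // truncnS_gt.
  have : 0 <= (1 - x) ^+ l by rewrite exprn_ge0 // subr_ge0.
  nra.
(* This [L] gives [q = j %/ l >= 64 * l * m.+1], whence [2 ^ m.+1 <= 2 ^ q] and
   [16 * l * q.+1 < 2 ^ q.+1]; so [4 ^ q] beats both factors. *)
exists (l * (64 * l))%N; first by rewrite !muln_gt0.
move=> m j hj; pose q := (j %/ l)%N.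
have q_ge : (64 * l * m.+1 <= q)%N.
  by rewrite leq_divRL //; apply: leq_trans hj; lia.
have hq : (16 * j < 16 * (l * q.+1))%N.
  by rewrite ltn_pmul2l // mulnC -ltn_divLR.
have bj : (1 - x) ^+ j <= (1 / 4) ^+ q.
  rewrite (divn_eq j l) exprD mulnC exprM -[leRHS]mulr1.
  rewrite ler_pM ?exprn_ge0 ?subr_ge0 ?lerXn2r ?nnegrE //.
  - by rewrite exprn_ge0 // subr_ge0.
  - by lra.
  - by rewrite exprn_ile1 ?subr_ge0 // lerBlDr lerDl ltW.
have key : (2 ^ m * (16 * j).+1 < 4 ^ q)%N.
  have h1 := @sqrn_lt_expn2 q.+1 isT.
  have h2 : (2 ^ m.+1 <= 2 ^ q)%N by rewrite leq_exp2l //; nia.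
  have h3 : (16 * (l * q.+1) < 2 ^ q.+1)%N by nia.
  have -> : (4 = 2 ^ 2)%N by [].
  rewrite -expnM mul2n -addnn expnD; move: h2 h3; rewrite !expnS => h2 h3.
  have p0 : (0 < 2 ^ m)%N by rewrite expn_gt0.
  nia.
apply: le_lt_trans (_ : 2 ^+ m * ((16 * j).+1%:R * (1 / 4) ^+ q) < 1).
  by rewrite !ler_wpM2l // exprn_ge0.
rewrite mulrA div1r exprVn ltr_pdivrMr ?exprn_gt0 // mul1r.
by rewrite -!natrX -natrM ltr_nat.
Qed.

(** * Sign of the Krawtchouk coefficients for small [a] *)

Lemma kraw0 (R : comNzRingType) (b k : nat) : kraw R 0 b k = 'C(b, k)%:R.
Proof.
rewrite /kraw expr0 mul1r exprDn coef_sum.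
under eq_bigr => i _ do rewrite expr1n mul1r coefMn coefXn.
case: (ltnP k b.+1) => hk.
  rewrite (bigD1 (Ordinal hk)) //= eqxx big1 ?addr0 // => i ne.
  rewrite (_ : (k == i) = false) ?mul0rn // eq_sym.
  by apply: contra_neqF ne => /eqP ?; apply: val_inj.
rewrite big1 ?bin_small // => i _.
by rewrite gtn_eqF ?mul0rn //; apply: leq_trans hk.
Qed.

(* For [16 j <= N] and [4 k <= N], the recurrence keeps the ratio of consecutive
   values above 1/4. *)
Lemma kraw_ge0 (R : realFieldType) (N k j : nat) :
  (4 * k <= N)%N -> (16 * j <= N)%N -> 0 <= kraw R j (N - j) k.
Proof.
move=> kN jN; have [N0|N0] := posnP N.
  by rewrite (_ : j = 0%N) ?kraw0 ?ler0n; last lia.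
suff: 0 <= kraw R j (N - j) k <= 4 * kraw R j.+1 (N - j.+1) k by case/andP.
have kN' : 4 * k%:R <= N%:R :> R by rewrite -natrM ler_nat.
elim: j jN => [|j IH] jN.
  have := kraw_rec R 0 N.-1 k; rewrite !kraw0 prednK // subn0 subn1 mul0r subr0.
  have : 0 < N%:R :> R by rewrite ltr0n.
  have : 0 <= 'C(N, k)%:R :> R by [].
  move: (kraw R 1 _ _) ('C(N, k)%:R) (N%:R) (k%:R) kN' => x y n K; nra.
have /andP[h1 h2] : 0 <= kraw R j (N - j) k <= 4 * kraw R j.+1 (N - j.+1) k.
  by apply: IH; lia.
have h : 0 <= kraw R j.+1 (N - j.+1) k by lra.
rewrite h /=.
have := kraw_rec R j.+1 (N - j.+2) k; rewrite /=.
have -> : ((N - j.+2).+1 = N - j.+1)%N by lia.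
have -> : ((N - j.+1).+1 = N - j)%N by lia.
have -> : ((j.+1 + (N - j.+2)).+1 = N)%N by lia.
have e : (N - j.+1)%:R = N%:R - j.+1%:R :> R by rewrite natrB //; lia.
have p0 : 0 < (N - j.+1)%:R :> R by rewrite ltr0n; lia.
have jN' : 16 * j.+1%:R <= N%:R :> R by rewrite -natrM ler_nat.
move=> r; rewrite -(ler_pM2l p0) mulrCA r.
have : 0 <= j.+1%:R :> R by [].
move: h h2 kN' jN'; rewrite e /=; clear.
(* As [4 * K <= n], [16 * J <= n] and [x <= 4 * y], the right side of the recurrence is at least
   [(n / 2 - n / 4) * y]. *)
move: (kraw R j _ _) (kraw _ _ _ _) (N%:R) (k%:R) (j.+1%:R) => x y n K J.
move=> *; nra.
Qed.

(** * Size of the Krawtchouk coefficients, by coefficientwise majorants *)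

Definition dominated (R : realDomainType) (p q : {poly R}) :=
  forall i, `|p`_i| <= q`_i.

Lemma dominatedM (R : realDomainType) (p q p' q' : {poly R}) :
  dominated p q -> dominated p' q' -> dominated (p * p') (q * q').
Proof.
move=> pq pq' i; rewrite !coefM; apply: le_trans (ler_norm_sum _ _ _) _.
by apply: ler_sum => j _; rewrite normrM ler_pM.
Qed.

Lemma dominatedX (R : realDomainType) (p q : {poly R}) (n : nat) :
  dominated p q -> dominated (p ^+ n) (q ^+ n).
Proof.
move=> pq; elim: n => [|n IH]; last by rewrite !exprS; apply: dominatedM.
by move=> i; rewrite !expr0 coef1; case: (i == _); rewrite ?normr1 ?normr0.
Qed.

(** Domination makes the coefficients of [q] nonnegative, so a single term is at most the whole
    value [q.[x]]. *)
Lemma dominated_horner (R : realDomainType) (p q : {poly R}) (x : R) (k : nat) :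
  dominated p q -> 0 <= x -> `|p`_k| * x ^+ k <= q.[x].
Proof.
move=> pq x0; have q0 i : 0 <= q`_i by apply: le_trans (pq i).
apply: le_trans (_ : q`_k * x ^+ k <= _); first by rewrite ler_wpM2r ?exprn_ge0.
have [kq|kq] := ltnP k (size q); last first.
  rewrite nth_default // mul0r horner_coef sumr_ge0 // => i _.
  by rewrite mulr_ge0 ?exprn_ge0.
rewrite horner_coef (bigD1 (Ordinal kq)) //= lerDl sumr_ge0 // => i _.
by rewrite mulr_ge0 ?exprn_ge0.
Qed.

(* The weights [binomial(N, i) (k / (N - k)) ^ i] are largest at [i = k]. *)
Lemma binomial_mode (R : realFieldType) (N k : nat) (x : R) :
  (k < N)%N -> x = k%:R / (N - k)%:R ->
  (1 + x) ^+ N <= N.+1%:R * ('C(N, k)%:R * x ^+ k).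
Proof.
move=> kN xE; have p0 : 0 < (N - k)%:R :> R by rewrite ltr0n subn_gt0.
have x0 : 0 <= x by rewrite xE divr_ge0.
pose f i : R := 'C(N, i)%:R * x ^+ i.
have f0 i : 0 <= f i by rewrite mulr_ge0 ?exprn_ge0.
have xe : x * (N%:R - k%:R) = k%:R.
  by rewrite xE -natrB 1?ltnW // divfK // gt_eqF.
have fS i : (i <= N)%N -> i.+1%:R * f i.+1 = (N%:R - i%:R) * x * f i.
  move=> iN; rewrite /f exprS mulrA -natrM mul_bin_left natrM natrB //; ring.
have kN' : k%:R < N%:R :> R by rewrite ltr_nat.
have up i : (i < k)%N -> f i <= f i.+1.
  move=> ik; have iN : (i <= N)%N by lia.
  have h : i%:R + 1 <= k%:R :> R by rewrite natr1 ler_nat.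
  rewrite -(@ler_pM2l _ i.+1%:R) ?ltr0n // fS // ler_wpM2r // -natr1.
  rewrite -(ler_pM2r p0) natrB 1?ltnW // -mulrA xe.
  move: h kN'; have : 0 <= i%:R :> R by [].
  move: (i%:R) (k%:R) (N%:R) => I K n; nra.
have down i : (k <= i)%N -> (i <= N)%N -> f i.+1 <= f i.
  move=> ik iN; have h : k%:R <= i%:R :> R by rewrite ler_nat.
  rewrite -(@ler_pM2l _ i.+1%:R) ?ltr0n // fS // ler_wpM2r // -natr1.
  rewrite -(ler_pM2r p0) natrB 1?ltnW // -mulrA xe.
  move: h kN'; have : 0 <= k%:R :> R by [].
  move: (i%:R) (k%:R) (N%:R) => I K n; nra.
have fk i : (i <= N)%N -> f i <= f k.
  have [ik|ki] := leqP i k => iN.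
    have [d ->] : exists d, i = (k - d)%N by exists (k - i)%N; lia.
    elim: d => [|d IH]; first by rewrite subn0.
    have [h|h] := ltnP d k; last by rewrite (_ : k - d.+1 = k - d)%N //; lia.
    apply: le_trans IH; have -> : (k - d = (k - d.+1).+1)%N by lia.
    by apply: up; lia.
  move: iN; rewrite -(subnKC (ltnW ki)); elim: (i - k)%N => [|d IH] iN.
    by rewrite addn0.
  rewrite addnS in iN *; apply: le_trans (down _ _ _) (IH _); lia.
rewrite addrC exprD1n (eq_bigr (fun i : 'I__ => f i)); last first.
  by move=> i _; rewrite /f mulr_natl.
apply: le_trans (_ : \sum_(i < N.+1) f k <= _).
  by apply: ler_sum => i _; apply: fk; rewrite -ltnS.
by rewrite sumr_const card_ord mulr_natl.
Qed.

(** Pairing [1 - 'X] with [1 + 'X] confines the signs to [1 - 'X ^+ 2], whose majorant [1 + 'X ^+ 2]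
    is smaller than [(1 + 'X) ^+ 2]; this is the source of the exponential saving. *)
Lemma kraw_fold (R : comNzRingType) (a b k : nat) : (a <= b)%N ->
  kraw R a b k = ((1 - 'X ^+ 2) ^+ a * (1 + 'X) ^+ (b - a))`_k.
Proof.
move=> ab; rewrite /kraw -[in (1 + 'X) ^+ b](subnKC ab) exprD mulrA -exprMn.
by have -> : (1 - 'X) * (1 + 'X) = 1 - 'X ^+ 2 :> {poly R} by ring.
Qed.

(** The majorant is evaluated at [y = k / (N - k)], where [binomial_mode] bounds [(1 + y) ^+ N] by
    [N.+1] times its term of degree [k]. *)
Lemma kraw_abs_le (R : realFieldType) (a b k : nat) (x : R) :
  (0 < k)%N -> (2 * k <= a + b)%N -> (a <= b)%N ->
  0 <= x -> x * (a + b)%:R <= k%:R ->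
  `|kraw R a b k| <= 'C(a + b, k)%:R * ((a + b).+1%:R * (1 - x) ^+ a).
Proof.
move=> k0 kN ab x0 xk; set N := (a + b)%N.
pose y : R := k%:R / (N - k)%:R.
have p0 : 0 < (N - k)%:R :> R by rewrite ltr0n; lia.
have K0 : 0 < k%:R :> R by rewrite ltr0n.
have eN : N%:R = k%:R + (N - k)%:R :> R by rewrite -natrD subnKC //; lia.
have y0 : 0 < y by rewrite divr_gt0.
have y1 : y <= 1 by rewrite ler_pdivrMr // mul1r ler_nat; lia.
have xy : x * (1 + y) <= y.
  rewrite -(ler_pM2r p0) -mulrA mulrDl mul1r divfK ?gt_eqF // addrC -eN.
  exact: xk.
have d1 : dominated (1 - 'X ^+ 2 : {poly R}) (1 + 'X ^+ 2) => [i|].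
  rewrite coefB coefD coef1 coefXn; case: i => [|[|[|i]]] /=;
  by rewrite ?subr0 ?addr0 ?sub0r ?normrN ?normr0 ?normr1 ?add0r.
have d2 : dominated (1 + 'X : {poly R}) (1 + 'X) => [i|].
  rewrite coefD coef1 coefX; case: i => [|[|i]] /=;
  by rewrite ?addr0 ?add0r ?normr0 ?normr1.
have h : `|kraw R a b k| * y ^+ k <= (1 + y ^+ 2) ^+ a * (1 + y) ^+ (b - a).
  rewrite kraw_fold //.
  have d12 := dominatedM (dominatedX a d1) (dominatedX (b - a) d2).
  have := dominated_horner k d12 (ltW y0).
  by rewrite !hornerE.
rewrite -(ler_pM2r (exprn_gt0 k y0)); apply: le_trans h _.
apply: le_trans (_ : (1 - x) ^+ a * (1 + y) ^+ N <= _).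
  rewrite (_ : N = (2 * a + (b - a))%N); last by rewrite /N; lia.
  rewrite exprD mulrA exprM -exprMn ler_wpM2r ?exprn_ge0 //; first by lra.
  (* From [x * (1 + y) <= y <= 1]: [(1 - x) * (1 + y) ^+ 2 >= 1 + y >= 1 + y ^+ 2]. *)
  by rewrite lerXn2r ?nnegrE //; nra.
rewrite mulrC !mulrA -mulrAC ler_wpM2r //.
  rewrite exprn_ge0 //; nra.
have := @binomial_mode R N k y; rewrite mulrCA mulrA; apply => //; lia.
Qed.

(** * Character sums over subsets of fixed size *)

Lemma prod_1D (R : comNzRingType) (I : finType) (D : {set I}) (f : I -> R) :
  \prod_(i in D) (1 + f i) =
  \sum_(J : {set I} | J \subset D) \prod_(i in J) f i.
Proof.
rewrite big_mkcond (eq_bigr (fun i => (if i \in D then f i else 0) + 1)).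
  2: by move=> i _; case: ifP; rewrite ?add0r // addrC.
rewrite bigA_distr [RHS]big_mkcond; apply: eq_bigr => J _.
rewrite -big_mkcond; case: ifPn => [/subsetP sJD|/subsetPn[i iJ iD]].
  by apply: eq_bigr => i /sJD ->.
by rewrite (bigD1 i) //= (negbTE iD) mul0r.
Qed.

Lemma sign_card (R : comNzRingType) (I : finType) (K A : {set I}) :
  (-1) ^+ #|K :&: A| = \prod_(i in K) (-1) ^+ (i \in A) :> R.
Proof.
rewrite -prodr_const (eq_bigl (fun i => (i \in K) && (i \in A))); last first.
  by move=> i; rewrite inE.
by rewrite big_mkcondr; apply: eq_bigr => i _; case: (i \in A).
Qed.

Definition char_sum (R : comNzRingType) (I : finType) (D A : {set I})
    (k : nat) : R :=
  \sum_(K : {set I} | (K \subset D) && (#|K| == k)) (-1) ^+ #|K :&: A|.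

(** Generating function: expanding one factor [1 - 'X] or [1 + 'X] per point of [D], inside or
    outside [A], yields one signed monomial per subset of [D]. *)
Lemma char_sum_kraw (R : comNzRingType) (I : finType) (D A : {set I})
    (k : nat) :
  char_sum R D A k = kraw R #|D :&: A| #|D :\: A| k.
Proof.
have -> : kraw R #|D :&: A| #|D :\: A| k =
    (\prod_(i in D) (1 + ((-1) ^+ (i \in A))%:P * 'X))`_k.
  rewrite (bigID (mem A)) /kraw /= -!prodr_const; congr ((_ : {poly R})`_k).
  congr (_ * _).
    rewrite (eq_bigl (fun i => (i \in D) && (i \in A))); last first.
      by move=> i; rewrite inE.
    by apply: eq_bigr => i /andP[_ ->]; rewrite expr1 polyCN mulN1r.
  rewrite (eq_bigl (fun i => (i \in D) && (i \notin A))).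
    by apply: eq_bigr => i /andP[_ /negbTE ->]; rewrite expr0 mul1r.
  by move=> i; rewrite inE andbC.
rewrite prod_1D coef_sum /char_sum big_mkcondr; apply: eq_bigr => K _.
rewrite big_split /= prodr_const -rmorph_prod -sign_card coefCM coefXn.
by rewrite eq_sym; case: eqP; rewrite ?mulr1 ?mulr0.
Qed.

(** For [#|K|] even, [K :&: A] and [K :\: A] have the same parity. *)
Lemma char_sumC (R : comNzRingType) (I : finType) (D A : {set I}) (k : nat) :
  ~~ odd k -> char_sum R D (~: A) k = char_sum R D A k.
Proof.
move=> k_even; apply: eq_bigr => K /andP[_ /eqP Kk].
rewrite -signr_odd -[RHS]signr_odd; congr (_ ^+ _).
by move: k_even; rewrite -Kk -(cardsID A K) setDE oddD; do 2!case: odd.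
Qed.

(** The symmetric difference of all members of [J]. *)
Definition odd_cover (I : finType) (J : {set {set I}}) : {set I} :=
  [set i | odd #|[set A in J | i \in A]|].

Lemma sign_odd_cover (R : comNzRingType) (I : finType)
    (J : {set {set I}}) (K : {set I}) :
  (-1) ^+ #|K :&: odd_cover J| = \prod_(A in J) (-1) ^+ #|K :&: A| :> R.
Proof.
under eq_bigr do rewrite sign_card.
rewrite sign_card exchange_big; apply: eq_bigr => i _ /=.
rewrite inE signr_odd -prodr_const.
transitivity (\prod_(A in J | i \in A) (-1) : R).
  by apply: eq_bigl => A; rewrite inE.
by rewrite big_mkcondr; apply: eq_bigr => A _; case: (i \in A).
Qed.

(** The product on the right is [2 ^+ #|F|] if [K] meets every member of [F] evenly and 0 otherwise,
    so a positive sum yields such a [K]. *)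
Lemma sum_char_sum (R : comNzRingType) (I : finType) (F : {set {set I}})
    (D : {set I}) (k : nat) :
  \sum_(J : {set {set I}} | J \subset F) char_sum R D (odd_cover J) k =
  \sum_(K : {set I} | (K \subset D) && (#|K| == k))
    \prod_(A in F) (1 + (-1) ^+ #|K :&: A|).
Proof.
rewrite exchange_big; apply: eq_bigr => K _ /=; rewrite prod_1D.
by apply: eq_bigr => J _; rewrite sign_odd_cover.
Qed.

(** In the decay hypothesis [j] stands for [#|D :&: A|], and [(16 * j).+1] bounds the factor
    [#|D|.+1] of [kraw_abs_le]. *)
Lemma char_sum_gt (R : realFieldType) (I : finType) (D A : {set I}) (k : nat)
    (x e : R) :
  ~~ odd k -> (0 < k)%N -> (4 * k <= #|D|)%N ->
  0 <= x -> x <= 1 -> x * #|D|%:R <= k%:R -> 0 < e ->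
  (forall j : nat, (#|D| <= 16 * j)%N -> (16 * j).+1%:R * (1 - x) ^+ j < e) ->
  - ('C(#|D|, k)%:R * e) < char_sum R D A k.
Proof.
move=> k_even k0 kD x0 x1 xD e0 decay.
wlog ab : A / (#|D :&: A| <= #|D :\: A|)%N.
  move=> W; have [|h] := leqP #|D :&: A| #|D :\: A|; first exact: W.
  by rewrite -char_sumC //; apply: W; rewrite setDE setCK -setDE ltnW.
rewrite char_sum_kraw; set a := #|_ :&: _|; set b := #|_ :\: _|.
have abD : (a + b = #|D|)%N by apply: cardsID.
have C0 : 0 < 'C(#|D|, k)%:R :> R by rewrite ltr0n bin_gt0; lia.
have [small|large] := leqP (16 * a) #|D|.
  apply: lt_le_trans (_ : 0 <= _); first by rewrite oppr_lt0 mulr_gt0.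
  have -> : b = (#|D| - a)%N by lia.
  exact: kraw_ge0.
rewrite ltrNl; apply: le_lt_trans (ler_norm _) _; rewrite normrN.
apply: le_lt_trans (kraw_abs_le _ _ _ x0 _) _; rewrite ?abD //; first by lia.
rewrite ltr_pM2l //; apply: le_lt_trans (decay a (ltnW large)).
by rewrite ler_wpM2r ?exprn_ge0 ?subr_ge0 // ler_nat ltnS ltnW.
Qed.

Lemma exists_even_set (R : realFieldType) (I : finType) (F : {set {set I}})
    (D : {set I}) (k : nat) (x : R) :
  ~~ odd k -> (0 < k)%N -> (4 * k <= #|D|)%N ->
  0 <= x -> x <= 1 -> x * #|D|%:R <= k%:R ->
  (forall j : nat, (#|D| <= 16 * j)%N ->
     2 ^+ #|F| * ((16 * j).+1%:R * (1 - x) ^+ j) < 1) ->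
  exists K : {set I}, [/\ K \subset D, #|K| = k
                        & forall A, A \in F -> ~~ odd #|K :&: A|].
Proof.
move=> k_even k0 kD x0 x1 xD decay.
have p0 : 0 < 2 ^+ #|F| :> R by rewrite exprn_gt0.
have C0 : 0 < 'C(#|D|, k)%:R :> R by rewrite ltr0n bin_gt0; lia.
pose e : R := 'C(#|D|, k)%:R * (2 ^+ #|F|)^-1.
have e0 : 0 < e by rewrite mulr_gt0 ?invr_gt0.
have term J : - e < char_sum R D (odd_cover J) k.
  apply: (@char_sum_gt _ _ D _ k x) => //; first by rewrite invr_gt0.
  by move=> j /decay; rewrite -[_^-1]mul1r ltr_pdivlMr // mulrC.
have : 0 < \sum_(J : {set {set I}} | J \subset F) char_sum R D (odd_cover J) k.
  (* [J = set0] contributes exactly the binomial, every other [J] more than [- e]; as [2 ^ #|F|]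
     copies of [e] add up to the binomial, the lower bound equals [e]. *)
  apply: lt_le_trans (_ : \sum_(J : {set {set I}} | J \subset F)
     ((J == set0)%:R * ('C(#|D|, k)%:R + e) - e) <= _).
    rewrite (eq_bigl (mem (powerset F))); last by move=> J; rewrite !inE.
    rewrite big_split /= sumr_const card_powerset.
    rewrite (bigD1 set0) ?inE ?sub0set //= eqxx mul1r big1; last first.
      by move=> J /andP[_ /negbTE ->]; rewrite mul0r.
    have -> : (- e) *+ 2 ^ #|F| = - 'C(#|D|, k)%:R.
      by rewrite mulNrn -[e *+ _]mulr_natr natrX divfK ?gt_eqF.
    by rewrite addr0 addrAC subrr add0r.
  apply: ler_sum => J _; have [->|_] := eqVneq J set0; last first.
    by rewrite mul0r add0r ltW.
  rewrite mul1r addrK char_sum_kraw.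
  have -> : odd_cover set0 = set0 :> {set I}.
    apply/setP => i; rewrite !inE (eq_card0 (_ : _ =i pred0)) // => A.
    by rewrite !inE.
  by rewrite setI0 setD0 cards0 kraw0.
rewrite sum_char_sum => pos.
have [K /andP[/andP[KD /eqP Kk] pK]] : exists K : {set I},
    ((K \subset D) && (#|K| == k)) &&
    (\prod_(A in F) (1 + (-1) ^+ #|K :&: A|) != 0 :> R).
  apply/existsP; apply: contraTT pos => /existsPn h.
  rewrite big1 ?ltxx // => K hK; have := h K; rewrite hK /= negbK.
  by move/eqP.
exists K; split => // A AF; apply: contraNN pK => odd_KA.
by rewrite (bigD1 A) //= -signr_odd odd_KA expr1 subrr mul0r.
Qed.

(** * Reducing the density by a parity argument *)

Lemma odd_card_symdiff (I : finType) (U V A : {set I}) :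
  odd #|((U :\: V) :|: (V :\: U)) :&: A| = odd #|U :&: A| (+) odd #|V :&: A|.
Proof.
rewrite -(cardsID V (U :&: A)) -(cardsID U (V :&: A)) !oddD.
have -> : U :&: A :&: V = V :&: A :&: U by rewrite setIAC [U :&: V]setIC setIAC.
rewrite setIUl cardsU.
have -> : (U :\: V) :&: A :&: ((V :\: U) :&: A) = set0.
  by apply/setP => i; rewrite !inE; do 3!case: (i \in _).
rewrite cards0 subn0 oddD !setIDAC.
by do 3!case: odd.
Qed.

(** Take [V] maximal. If more than [#|F|] points of [S] were left, two subsets of [S :\: V] would
    have the same parities against [F], and their symmetric difference could be added to [V]. *)
Lemma even_subset_codim (I : finType) (F : {set {set I}}) (S : {set I}) :
  exists V : {set I}, [/\ V \subset S, (#|S| <= #|V| + #|F|)%N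
                        & forall A, A \in F -> ~~ odd #|V :&: A|].
Proof.
pose P (V : {set I}) := (V \subset S) && [forall A in F, ~~ odd #|V :&: A|].
have P0 : P set0.
  by rewrite /P sub0set; apply/forall_inP => A _; rewrite set0I cards0.
have [V /andP[VS /forall_inP Veven] Vmax] :=
  arg_maxnP (fun V : {set I} => #|V|) P0.
exists V; split=> //; rewrite leqNgt; apply/negP => lt_card.
have FD : (#|F| < #|S :\: V|)%N by rewrite cardsDS //; lia.
pose f (W : {set I}) := [set A in F | odd #|W :&: A|].
have : ~~ dinjectiveb f (mem (powerset (S :\: V))).
  apply/negP => /dinjectiveP inj_f.
  have /subset_leq_card :
      [set f W | W in powerset (S :\: V)] \subset powerset F.
    apply/subsetP => _ /imsetP[W _ ->]; rewrite inE.
    by apply/subsetP => A /[!inE] /andP[].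
  by rewrite card_in_imset // !card_powerset leq_exp2l // leqNgt FD.
case/dinjectivePn => U US [W /andP[neWU WS] eqf].
rewrite !inE in US WS neWU.
pose X := (U :\: W) :|: (W :\: U).
have XSV : X \subset S :\: V.
  by rewrite subUset !(subset_trans (subsetDl _ _)).
have X0 : (0 < #|X|)%N.
  rewrite card_gt0; apply: contraNneq neWU => /eqP.
  by rewrite setU_eq0 !setD_eq0 eqEsubset andbC.
have XV A : (V :&: A) :&: (X :&: A) = set0.
  apply/setP => i; rewrite !inE; apply/negP => /and3P[/andP[iV _] + _].
  by move=> iX; have := subsetP XSV i; rewrite !inE iX iV => /(_ isT).
have := Vmax (V :|: X); rewrite cardsU.
have := XV setT; rewrite !setIT => ->; rewrite cards0 subn0.
have : P (V :|: X).
  rewrite /P subUset VS (subset_trans XSV) ?subsetDl //=.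
  apply/forall_inP => A AF; rewrite setIUl cardsU XV cards0 subn0 oddD.
  rewrite (negbTE (Veven A AF)) odd_card_symdiff.
  by have /setP/(_ A) := eqf; rewrite !inE AF /= => ->; rewrite addbb.
move=> -> /(_ isT); lia.
Qed.

Lemma exists_set_card (I : finType) (k : nat) : (k <= #|I|)%N ->
  exists K : {set I}, #|K| = k.
Proof.
move=> kI; have : (0 < #|[set A : {set I} | #|A| == k]|)%N.
  by rewrite card_draws bin_gt0.
by case/card_gt0P => K /[!inE] /eqP; exists K.
Qed.

Lemma exists_even_kset (R : realType) (eps : R) : 0 < eps -> eps < 1 / 2 ->
  exists2 delta : R, 0 < delta &
    forall (I : finType) (F : {set {set I}}) (k : nat),
      ~~ odd k -> eps * #|I|%:R < k%:R -> k%:R < (1 - eps) * #|I|%:R ->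
      #|F|%:R < delta * #|I|%:R ->
      exists2 K : {set I}, #|K| = k & forall A, A \in F -> ~~ odd #|K :&: A|.
Proof.
move=> eps0 eps_half; pose x := eps / 12.
have x0 : 0 < x by rewrite /x; lra.
have x1 : x <= 1 by rewrite /x; lra.
have [L L0 decay] := geometric_decay x0 x1.
have L1 : 1 <= L%:R :> R by rewrite ler1n.
(* With this constant, [F] is empty when [eps * n <= 32 * L]; otherwise
   [16 * L * (#|F| + 1) < eps * n], as the decay requires. *)
exists (eps / (32 * L%:R)); first by rewrite divr_gt0 // mulr_gt0 // ltr0n.
move=> I F k k_even; set n := #|I| => epsk keps Fsmall.
have n0 : 0 <= n%:R :> R by [].
have en0 : 0 <= eps * n%:R by rewrite mulr_ge0 // ltW.
have kn : (k <= n)%N by rewrite -(ler_nat R); nra.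
have {}Fsmall : 32 * (L%:R * #|F|%:R) < eps * n%:R.
  by move: Fsmall; rewrite mulrAC ltr_pdivlMr; [rewrite mulrC mulrA|lra].
have [n_small|n_large] := leP (eps * n%:R) (32 * L%:R).
  have -> : F = set0.
    apply/eqP; rewrite -cards_eq0 -leqn0 -ltnS -(ltr_nat R); nra.
  have [K Kk] := exists_set_card kn; by exists K => // A; rewrite inE.
pose t := Num.truncn (eps * n%:R / 6).
have /andP[t_le t_gt] : t%:R <= eps * n%:R / 6 < t.+1%:R.
  by rewrite truncn_itv // divr_ge0.
rewrite -[t.+1%:R]natr1 in t_gt.
have F0 : 0 <= #|F|%:R :> R by [].
have FL : 16 * (L%:R * (#|F|%:R + 1)) < eps * n%:R by lra.
have Ft : (#|F|.+1 <= t)%N by rewrite -(ler_nat R) -natr1; nra.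
have tk : (t <= k)%N by rewrite -(ler_nat R); lra.
have tn : (6 * t < n - k)%N.
  by rewrite -(ltr_nat R) natrM natrB //; lra.
have [S Sk] := @exists_set_card I (k - t) (leq_trans (leq_subr _ _) kn).
(* Adding [setT] to the family makes [#|V|], hence [k - #|V|], even, at the cost of one more
   point. *)
have [V [VS V_large V_even]] := even_subset_codim (setT |: F) S.
have cF : (#|setT |: F| <= #|F|.+1)%N.
  by rewrite cardsU1 -add1n leq_add2r leq_b1.
have Vk := subset_leq_card VS.
have cV : (#|~: V| + #|V| = n)%N by rewrite addnC cardsC.
have V_ev : ~~ odd #|V|.
  by have := V_even setT; rewrite setIT; apply; rewrite !inE eqxx.
(* Here [k - #|V| <= t + #|F|.+1 <= 2 * t], while [#|~: V| = (n - k) + (k - #|V|)] with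
   [n - k > 6 * t]. *)
have [[kV1 kV2] [kV3 kV4]] : ((t <= k - #|V|)%N /\ (#|V| <= k)%N) /\
    ((4 * (k - #|V|) <= #|~: V|)%N /\ (n - k <= #|~: V|)%N).
  move: Vk cF V_large cV Ft tk tn kn; rewrite Sk; clear; clearbody n t.
  by move: #|~: V| #|V| #|setT |: F| #|F| => *; lia.
have t0 : (0 < t)%N by apply: leq_trans Ft.
have [K' [K'V K'k K'even]] : exists K' : {set I},
    [/\ K' \subset ~: V, #|K'| = (k - #|V|)%N
      & forall A, A \in F -> ~~ odd #|K' :&: A|].
  apply: (@exists_even_set R _ _ _ _ x) => //.
  - by rewrite oddB // (negbTE k_even) (negbTE V_ev).
  - exact: leq_trans kV1.
  - exact: ltW.
  - apply: (@le_trans _ _ t%:R); last by rewrite ler_nat.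
    apply: (@le_trans _ _ (x * n%:R)).
      by rewrite ler_pM2l // ler_nat -cV leq_addr.
    rewrite /x; lra.
  - move=> j hj; apply: decay; rewrite -(ler_nat R) natrM -natr1.
    have : (n - k)%:R <= 16 * j%:R :> R.
      by rewrite -natrM ler_nat (leq_trans kV4).
    by rewrite natrB //; lra.
have VK' : [disjoint V & K'] by rewrite disjoint_sym disjoints_subset.
exists (V :|: K') => [|A AF].
  by rewrite cardsU (disjoint_setI0 VK') cards0 K'k subn0 subnKC.
rewrite setIUl cardsU setIACA setIid (disjoint_setI0 VK') set0I cards0 subn0.
by rewrite oddD (negbTE (K'even _ AF)) (negbTE (V_even _ _)) // !inE AF orbT.
Qed.

(** * From even intersections to unbiased representatives *)

Definition indicator_bicoloring (n : nat) (K : {set 'I_n}) : bicoloring n :=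
  [ffun i => i \in K].

Lemma indicator_kbicoloring (n k : nat) (K : {set 'I_n}) :
  #|K| = k -> is_kbicoloring k (indicator_bicoloring K).
Proof.
move=> Kk; apply/eqP; rewrite -Kk; apply: eq_card => i.
by rewrite !inE mxE ffunE; case: (i \in K).
Qed.

(** The inner product is the number of points of [A] inside [K] minus the number outside. *)
Lemma unbiased_rep_card (n : nat) (A K : {set 'I_n}) :
  unbiased_rep A (indicator_bicoloring K) -> #|A| = (2 * #|K :&: A|)%N.
Proof.
case/andP=> _ /eqP.
have -> : inner (Xvec A) (Yvec (indicator_bicoloring K)) =
    #|A :&: K|%:R - #|A :\: K|%:R.
  rewrite /inner -!sumr_const -sumrN.
  rewrite !(big_mkcond (fun i => i \in _)) -big_split.
  apply: eq_bigr => i _; rewrite !mxE !inE ffunE /=.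
  by case: (i \in A); case: (i \in K).
have := cardsID K A; rewrite setIC; lia.
Qed.

Theorem theorem4 (R : realType) (eps : R) (eps_gt0 : 0 < eps)
    (eps_lt_half : eps < 1 / 2) :
  exists2 delta : R, 0 < delta &
    forall (n c r k : nat),
      (0 < n)%N ->
      odd c -> (1 <= c)%N -> c%:R <= n%:R / 2 :> R -> r = (2 * c)%N ->
      ~~ odd k -> eps * n%:R < k%:R -> k%:R < (1 - eps) * n%:R ->
      ((delta * n%:R)%:E <= gamma R n k r)%E.
Proof.
have [delta delta0 even_kset] := exists_even_kset eps_gt0 eps_lt_half.
exists delta => // n c r k _ c_odd _ _ -> k_even epsk keps.
apply: (bigmax_sup [set B | is_kbicoloring k B]).
  by apply/forall_inP => B; rewrite inE.
apply/bigmin_geP; split=> [|F /andP[/forall_inP F_unif /forall_inP F_SUR]].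
  (* The default value [+oo] of the minimum must satisfy the bound too. *)
  exact: leey.
rewrite lee_fin leNgt; apply/negP => F_small.
have [|||K Kk K_even] := even_kset 'I_n F k k_even; rewrite ?card_ord //.
have /exists_inP[A AF /unbiased_rep_card cA] :
    [exists A in F, unbiased_rep A (indicator_bicoloring K)].
  by apply: F_SUR; rewrite inE indicator_kbicoloring.
have /eqP := F_unif _ AF; rewrite cA => /eqP; rewrite eqn_mul2l /= => /eqP cK.
by have := K_even _ AF; rewrite cK c_odd.
Qed.
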